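(* Let $n\ge 1$ be an integer and let $T>0$ be a real number. Let $P$ be the transition matrix of the (random-scan) Gibbs sampler for the two-dimensional $n\times n$ Ising model with two states $\pm1$, free boundary condition and temperature $T$, and let $\beta_1$ be its second largest eigenvalue. Then $$\beta_1 \le 1 - n^{-4}\exp\Big\{-\tfrac{2}{T}(2n+1)\Big\}.$$
   Context: State space: $\chi=\{-1,1\}^{n^2}$, whose elements are written $x=(x^j_i)_{1\le i,j\le n}$. Ising distribution on $\chi$ (free boundary condition, temperature $T>0$): $$\pi(x)=\frac{1}{Z_T}\exp\Big\{\tfrac1T\Big(\sum_{j=1}^{n}\sum_{i=1}^{n-1}x^j_i x^j_{i+1}+\sum_{i=1}^{n}\sum_{j=1}^{n-1}x^j_i x^{j+1}_i\Big)\Big\},$$ where $Z_T$ is the normalizing constant making $\pi$ a probability measure on $\chi$. For $x,y\in\chi$, $d(x,y)$ denotes the number of sites $(i,j)\in\{1,\dots,n\}^2$ with $x^j_i\ne y^j_i$. For $x\in\chi$, a site $(i,j)$ and $s\in\{-1,1\}$, let $x^{(i,j)\to s}$ be the configuration that equals $s$ at site $(i,j)$ and agrees with $x$ at all other sites, and let $$\pi_{i,j}(s\mid x)=\frac{\pi(x^{(i,j)\to s})}{\pi(x^{(i,j)\to s})+\pi(x^{(i,j)\to -s})}$$ be the conditional probability of value $s$ at site $(i,j)$ given the other coordinates of $x$. Gibbs sampler (a uniformly random coordinate is updated according to its conditional distribution given the other coordinates): the transition matrix $P$ on $\chi$ is - $P(x,y)=\frac{1}{n^2}\,\pi_{i,j}(y^j_i\mid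 x)$ if $d(x,y)=1$ and $(i,j)$ is the site with $x^j_i\ne y^j_i$; - $P(x,x)=1-\frac{1}{n^2}\sum_{i,j=1}^n \pi_{i,j}(-x^j_i\mid x)$; - $P(x,y)=0$ otherwise. $P$ is irreducible, aperiodic and reversible with respect to $\pi$; its eigenvalues, counted with multiplicity, are real and are arranged as $1=\beta_0>\beta_1\ge\beta_2\ge\cdots\ge\beta_{|\chi|-1}>-1$. *)

(* Defs.v *)
From mathcomp Require Import all_boot all_order all_algebra.
From mathcomp Require Import polyrcf.
From mathcomp Require Import reals sequences exp.
Set Implicit Arguments.
Unset Strict Implicit.
Unset Printing Implicit Defensive.
Import Order.TTheory GRing.Theory Num.Theory.
Local Open Scope ring_scope.

(* The sites are the pairs (i, j), and [x (i, j)] is the spin x^j_i; indices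
   run over {0, .., n-1}. *)
Notation site n := ('I_n * 'I_n)%type.

(* [true] stands for the spin 1 and [false] for the spin -1, so that [~~ s]
   is the spin -s. *)
Notation config n := {ffun site n -> bool}.

Definition setspin (n : nat) (x : config n) (v : site n) (s : bool) : config n :=
  [ffun w => if w == v then s else x w].

Definition dist (n : nat) (x y : config n) : nat := #|[set v | x v != y v]|.

Section Ising.
Variables (R : realType) (n : nat) (T : R).

Definition spin (s : bool) : R := if s then 1 else -1.

(* A pair [p] with [p.2 = p.1 + 1] plays the role of (i, i + 1) with
   1 <= i <= n - 1. *)
Definition interaction (x : config n) : R :=
  \sum_(j < n) \sum_(p : 'I_n * 'I_n | p.2 == p.1.+1 :> nat)
     spin (x (p.1, j)) * spin (x (p.2, j))
  + \sum_(i < n) \sum_(p : 'I_n * 'I_n | p.2 == p.1.+1 :> nat)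
     spin (x (i, p.1)) * spin (x (i, p.2)).

Definition weight (x : config n) : R := expR (T^-1 * interaction x).

Definition partition_fun : R := \sum_(x : config n) weight x.

Definition ising (x : config n) : R := partition_fun^-1 * weight x.

Definition cond_ising (v : site n) (s : bool) (x : config n) : R :=
  ising (setspin x v s) / (ising (setspin x v s) + ising (setspin x v (~~ s))).

(* When [dist x y == 1], the [pick] returns the unique site where x and y
   differ. *)
Definition gibbs (x y : config n) : R :=
  if x == y then 1 - (n%:R ^+ 2)^-1 * \sum_(v : site n) cond_ising v (~~ x v) x
  else if dist x y == 1%N then
    if [pick v | x v != y v] is Some v
    then (n%:R ^+ 2)^-1 * cond_ising v (y v) x else 0
  else 0.

End Ising.

Definition kernel_mx (R : realType) (S : finType) (K : S -> S -> R) : 'M[R]_#|S| :=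
  \matrix_(a, b) K (enum_val a) (enum_val b).

(* The real eigenvalues of [A], each repeated according to its algebraic
   multiplicity, in nonincreasing order. *)
Definition eigenvalues (R : realType) (m : nat) (A : 'M[R]_m) : seq R :=
  sort >=%R
    (flatten [seq nseq (mup b (char_poly A)) b | b <- rootsR (char_poly A)]).

(* As soon as the characteristic polynomial splits over the reals (as it does
   for a reversible kernel), [eigenvalues] is the full spectrum. *)
Lemma eigenvaluesP (R : realType) (m : nat) (A : 'M[R]_m) (s : seq R) :
  char_poly A = \prod_(b <- s) ('X - b%:P) -> sorted >=%R s ->
  eigenvalues A = s.
Proof.
move=> As ss; have p0 : char_poly A != 0 by apply/monic_neq0/char_poly_monic.
suff H : perm_eq (flatten [seq nseq (mup b (char_poly A)) b
    | b <- rootsR (char_poly A)]) s.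
  have tr : transitive (>=%R : rel R) by move=> a b c ba cb; exact: le_trans cb ba.
  apply: (sorted_eq tr) => //; first by move=> a b; rewrite andbC; exact: le_anti.
    by apply: sort_sorted => a b; exact: le_total.
  by rewrite /eigenvalues perm_sort.
apply/allP => /= c _; apply/eqP.
have mupE t : mup c (\prod_(b <- t) ('X - b%:P)) = count_mem c t :> nat.
  elim: t => [|b t IH]; first by rewrite big_nil mupNroot ?root1.
  rewrite big_cons mupM ?polyXsubC_eq0 //; last first.
    by apply/monic_neq0/monic_prod_XsubC.
  by rewrite IH -['X - b%:P]expr1 mup_XsubCX /=; case: eqP.
rewrite -(mupE s) -As count_flatten -map_comp.
have -> : [seq (count_mem c \o (fun b => nseq (mup b (char_poly A)) b)) b
     | b <- rootsR (char_poly A)]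
   = [seq ((b == c) * mup c (char_poly A))%N | b <- rootsR (char_poly A)].
  by apply: eq_map => b /=; rewrite count_nseq /=; case: (b =P c) => [->|].
rewrite sumnE big_map -big_distrl /=.
have -> : (\sum_(b <- rootsR (char_poly A)) (b == c) = (c \in rootsR (char_poly A)))%N.
  rewrite -(count_uniq_mem c (uniq_roots _ _ _)) -sum1_count [RHS]big_mkcond /=.
  by apply: eq_bigr => b _; case: (b =P c).
have := roots_on_rootsR p0 c; rewrite in_itv /= => <-.
by case: (boolP (root _ c)) => [_|/mupNroot->]; rewrite ?mul1n.
Qed.

(* [k] counts from 0: [beta A 1] is the second largest eigenvalue. *)
Definition beta (R : realType) (m : nat) (A : 'M[R]_m) (k : nat) : R :=
  nth 0 (eigenvalues A) k.

(* Main.v *)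
Require Import Defs.
From mathcomp Require Import all_boot all_order all_algebra.
From mathcomp Require Import polyrcf.
From mathcomp Require Import reals sequences exp.
From mathcomp Require Import ring lra zify.
Set Implicit Arguments.
Unset Strict Implicit.
Unset Printing Implicit Defensive.
Import Order.TTheory GRing.Theory Num.Theory.
Local Open Scope ring_scope.

(** Let pi be the Ising measure and E(f, f) = <f, (I - P) f>_pi the Dirichlet
    form.  The heart of the matter is a Poincare inequality
      Var f <= n^4 exp (3 (n + 1) / T) E(f, f),
    which gives the bound since 3 (n + 1) <= 2 (2 n + 1).

    It is obtained with canonical paths: the path from x to y sweeps the sites
    in lexicographic order and replaces the spins of x by those of y.  Its
    length is at most n^2, so Cauchy-Schwarz ([path_sqr_le]) bounds Var f by
    n^2 / 2 times the sum, over the sites v and the configurations z, of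
    (f (z reversed at v) - f z)^2 times the total pi x pi y of the paths that
    cross that edge ([load]).  If B is the set of sites swept before v, the
    pair (x, y) is coded by z and by the complementary configuration u, which
    equals x on B and y off B ([sum_path_step]).

    The energies of x, y and z differ from those of the edges not cut by B only
    by the energy of the at most n + 1 edges that B cuts ([card_cut_before]),
    so H(x) + H(y) - H(z) is at most 3 (n + 1) plus the energy of u without
    the cut edges.  Reversing the spins of B shows that removing the cut edges
    does not increase the partition function ([sum_inner_le]), and fixing the
    spin of u at v halves the sum over u ([sum_inner_spin]).  Hence the load is at most
    1/2 exp (3 (n + 1) / T) times pi z, and likewise times the weight of the
    other end of the edge ([sum_ising_merge_le], [load_flip]); these two bounds
    together yield one by the equilibrium flow pi z P(z, z') up to the factor
    n^2 ([load_le_flow]).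

    For the passage to eigenvalues, the matrix with all rows equal to pi is
    subtracted from P: this moves one eigenvalue 1 to 0 and keeps the others,
    with their algebraic multiplicities ([char_poly_deflate]).  The eigenvectors
    of the deflated matrix for a nonzero eigenvalue have mean zero, so all its
    eigenvalues obey the bound, which is nonnegative ([deflated_root_le]); thus at most one
    eigenvalue of P, counted with multiplicity, exceeds it ([beta1_le]). *)

(** * Eigenvalues other than the first *)

(** Subtracting the rank-one matrix [u *m v] moves the eigenvalue [1], with
    right eigenvector [u], to [0] and leaves the others unchanged.  Both sides
    are the determinant of the same block matrix, multiplied on the right by
    two different block triangular matrices. *)
Lemma char_poly_deflate (R : idomainType) (m : nat) (A : 'M[R]_m)
    (u : 'cV[R]_m) (v : 'rV[R]_m) :
  A *m u = u -> v *m u = 1%:M ->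
  'X * char_poly A = ('X - 1%:P) * char_poly (A - u *m v).
Proof.
move=> Au vu.
set U := map_mx polyC u; set V := map_mx polyC v.
set B := map_mx polyC A.
have BU : B *m U = U by rewrite -map_mxM Au.
have VU : V *m U = 1%:M by rewrite -map_mxM vu map_scalar_mx.
pose C : 'M[{poly R}]_m := 'X%:M - (B - U *m V).
have CE : \det C = char_poly (A - u *m v).
  by rewrite /C /char_poly /char_poly_mx map_mxB map_mxM.
pose M := block_mx (1%:M : 'M_1) V U C.
have detM : \det M = char_poly A.
  have : \det (M *m block_mx 1%:M (- V) 0 1%:M) = char_poly A.
    rewrite mulmx_block !mul1mx !mulmx1 !mulmx0 !addr0 addNr det_lblock det1 mul1r.
    rewrite mulmxN; congr (\det _).
    by rewrite /C /char_poly_mx -/B opprB addrCA addKr.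
  by rewrite det_mulmx det_ublock !det1 !mulr1.
have : \det (M *m block_mx ('X%:M : 'M_1) 0 (- U) 1%:M)
    = ('X - 1%:P) * char_poly (A - u *m v).
  rewrite mulmx_block !mul1mx !mulmx1 !mulmx0 !add0r mulmxN VU.
  have -> : U *m 'X%:M + C *m - U = 0.
    rewrite mulmxN /C !mulmxBl BU -mulmxA VU mulmx1 subrr subr0.
    by rewrite mul_mx_scalar mul_scalar_mx subrr.
  rewrite det_ublock CE; congr (_ * _).
  by rewrite det_mx11 !mxE eqxx.
by rewrite det_mulmx det_lblock det1 mulr1 det_scalar1 detM mulrC => ->.
Qed.

(** If all eigenvalues of the deflated matrix are at most [t >= 0], then at
    most one eigenvalue of [A], counted with multiplicity, exceeds [t]. *)
Lemma beta1_le (R : realType) (m : nat) (A : 'M[R]_m)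
    (u : 'cV[R]_m) (v : 'rV[R]_m) (t : R) :
  A *m u = u -> v *m u = 1%:M -> 0 <= t ->
  (forall b, root (char_poly (A - u *m v)) b -> b <= t) ->
  beta A 1 <= t.
Proof.
move=> Au vu t0 Ht; rewrite /beta.
pose p := char_poly A; pose q := char_poly (A - u *m v).
have p0 : p != 0 by exact/monic_neq0/char_poly_monic.
have q0 : q != 0 by exact/monic_neq0/char_poly_monic.
have mupE b : t < b -> mup b p = (b == 1) :> nat.
  move=> tb.
  have b0 : b != 0 by rewrite gt_eqF // (le_lt_trans t0).
  have /(congr1 (mup b)) := char_poly_deflate Au vu.
  rewrite !mupM ?polyX_eq0 ?polyXsubC_eq0 // -/p -/q.
  rewrite mupNroot ?rootX // add0n => ->.
  rewrite [X in (_ + X)%N]mupNroot ?addn0; last first.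
    by apply/negP => /Ht; rewrite leNgt tb.
  by rewrite -['X - _]expr1 mup_XsubCX eq_sym; case: (b == 1).
have cnt : (count (> t) (eigenvalues A) <= 1)%N.
  rewrite /eigenvalues (permP (permEl (perm_sort _ _))) count_flatten -map_comp.
  rewrite sumnE big_map.
  apply: (@leq_trans (\sum_(b <- rootsR p) (b == 1%R))%N).
    apply: leq_sum => c _ /=; rewrite count_nseq.
    by case: ltP => // tc; rewrite mul1n mupE.
  have := count_uniq_mem (1 : R) (uniq_roots _ _ _ : uniq (rootsR (char_poly A))).
  rewrite -sum1_count big_mkcond /= => E.
  rewrite (eq_bigr (fun b => if b == 1 then 1%N else 0%N)); last first.
    by move=> b _; case: (b == 1).
  by rewrite E leq_b1.
have srt : sorted >=%R (eigenvalues A).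
  by apply: sort_sorted => a b; exact: le_total.
(* with fewer than two real eigenvalues, [beta A 1] is the default value 0 *)
case: (eigenvalues A) srt cnt => [|a [|b s]] //= /andP[ba _] cnt.
rewrite leNgt; apply/negP => tb.
by move: cnt; rewrite tb (lt_le_trans tb ba).
Qed.

(** * Ferromagnetic Ising weights across a cut *)

(** The configuration that agrees with [y] on [B] and with [x] off [B]. *)
Definition merge (V : finType) (B : {set V}) (y x : {ffun V -> bool}) :
  {ffun V -> bool} := [ffun v => if v \in B then y v else x v].

(** The configuration [x] with all spins in [B] reversed. *)
Definition flip (V : finType) (B : {set V}) (x : {ffun V -> bool}) :
  {ffun V -> bool} := [ffun v => x v (+) (v \in B)].

Lemma flipK (V : finType) (B : {set V}) : involutive (flip B).
Proof. by move=> x; apply/ffunP => v; rewrite !ffunE -addbA addbb addbF. Qed.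

Lemma flip_inj (V : finType) (B : {set V}) : injective (flip B).
Proof. exact/inv_inj/flipK. Qed.

Lemma merge_merge (V : finType) (B : {set V}) (x y : {ffun V -> bool}) :
  merge B (merge B x y) (merge B y x) = x.
Proof. by apply/ffunP => v; rewrite !ffunE; case: (v \in B). Qed.

Lemma spin_addb (R : realType) (s t : bool) :
  spin R (s (+) t) = (-1) ^+ t * spin R s.
Proof. by case: s t => [] [] /=; rewrite /spin ?expr0 ?expr1; ring. Qed.

Lemma norm_spin (R : realType) (s : bool) : `|spin R s| = 1.
Proof. by case: s; rewrite /= ?normrN normr1. Qed.

Lemma cosh_ge1 (R : realType) (c : R) : 2 <= expR c + expR (- c).
Proof. have := expR_ge1Dx c; have := expR_ge1Dx (- c); lra. Qed.

Section Cut.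
(* A finite multigraph on [V]: its edges are the [e] with [Pe e], joining
   [src e] to [tgt e]. *)
Variables (R : realType) (V E : finType) (Pe : pred E) (src tgt : E -> V).
Implicit Types (x y z u : {ffun V -> bool}) (B : {set V}).

Let bond x e : R := spin R (x (src e)) * spin R (x (tgt e)).

(** The sum of the products of neighbouring spins, that is minus the physical
    energy: configurations with aligned spins have the larger values. *)
Definition energy x : R := \sum_(e | Pe e) bond x e.

Definition cut B : pred E :=
  [pred e | Pe e && ((src e \in B) != (tgt e \in B))].

(** The energy of the edges inside [B] or inside its complement. *)
Definition inner B x : R :=
  \sum_(e | Pe e && ((src e \in B) == (tgt e \in B))) bond x e.

(** The energy of the edges between [B] and its complement. *)
Definition cross B x : R := \sum_(e | cut B e) bond x e.

Lemma energyE B x : energy x = inner B x + cross B x.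
Proof. by rewrite /energy (bigID (fun e => (src e \in B) == (tgt e \in B))). Qed.

Lemma inner_merge B u z :
  inner B (merge B u z) + inner B (merge B z u) = inner B u + inner B z.
Proof.
rewrite /inner -!big_split /=; apply: eq_bigr => e /andP[_ /eqP E1].
by rewrite /bond !ffunE -E1; case: (src e \in B) => //; rewrite addrC.
Qed.

Lemma norm_cross_le B x : `|cross B x| <= #|cut B|%:R.
Proof.
apply: (le_trans (ler_norm_sum _ _ _)).
rewrite (eq_bigr (fun=> 1)) ?sumr_const //.
by move=> e _; rewrite normrM !norm_spin mulr1.
Qed.

Lemma inner_flip B x : inner B (flip B x) = inner B x.
Proof.
apply: eq_bigr => e /andP[_ /eqP E1].
by rewrite /bond !ffunE !spin_addb E1 mulrACA -expr2 sqrr_sign mul1r.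
Qed.

Lemma inner_flipT B x : inner B (flip [set: V] x) = inner B x.
Proof.
apply: eq_bigr => e _.
by rewrite /bond !ffunE !spin_addb !inE mulrACA -expr2 sqrr_sign mul1r.
Qed.

Lemma cross_flip B x : cross B (flip B x) = - cross B x.
Proof.
rewrite /cross -sumrN; apply: eq_bigr => e /andP[_ E1].
by rewrite /bond !ffunE !spin_addb; move: E1; do 2![case: (_ \in B)] => //= _;
  rewrite ?expr0 ?expr1; ring.
Qed.

(** Reversing all the spins of [B] changes the sign of [cross B] only, and
    [cosh >= 1]: removing the edges of a cut does not increase the partition
    function. *)
Lemma sum_inner_le (b : R) B :
  \sum_x expR (b * inner B x) <= \sum_x expR (b * energy x).
Proof.
have E1 : \sum_x expR (b * energy x)
    = \sum_x expR (b * inner B x) * expR (b * cross B x).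
  by apply: eq_bigr => x _; rewrite (energyE B) mulrDr expRD.
have E2 : \sum_x expR (b * energy x)
    = \sum_x expR (b * inner B x) * expR (- (b * cross B x)).
  rewrite E1 (reindex_inj (flip_inj (B := B))) /=.
  by apply: eq_bigr => x _; rewrite inner_flip cross_flip mulrN.
rewrite -(ler_pM2l (_ : 0 < 2)) // [leRHS](_ : _ =
  \sum_x expR (b * inner B x) * expR (b * cross B x)
  + \sum_x expR (b * inner B x) * expR (- (b * cross B x))); last first.
  by rewrite -E1 -E2; ring.
rewrite -big_split /= mulr_sumr; apply: ler_sum => x _.
by rewrite -mulrDr mulrC ler_pM2l ?expR_gt0 // cosh_ge1.
Qed.

(** By the global spin reversal, either value at [v] carries half of the
    mass. *)
Lemma sum_inner_spin (b : R) B v s :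
  \sum_(x : {ffun V -> bool} | x v == s) expR (b * inner B x)
  = 2^-1 * \sum_x expR (b * inner B x).
Proof.
have E1 : \sum_(x : {ffun V -> bool} | x v != s) expR (b * inner B x)
    = \sum_(x : {ffun V -> bool} | x v == s) expR (b * inner B x).
  rewrite (reindex_inj (flip_inj (B := [set: V]))) /=; apply: eq_big => x.
    by rewrite !ffunE inE addbT; case: (x v) s => [] [].
  by rewrite inner_flipT.
by rewrite [in RHS](bigID (fun x : {ffun V -> bool} => x v == s)) /= E1; field.
Qed.

(** The congestion estimate: exchanging [u] and [z] on [B] changes the total
    energy by cut edges only, and the three cut energies involved are at most
    [#|cut B|] each. *)
Lemma sum_merge_le (b : R) B z v s : 0 <= b ->
  \sum_(u : {ffun V -> bool} | u v == s)
     expR (b * energy (merge B u z)) * expR (b * energy (merge B z u))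
  <= 2^-1 * expR (b * (3 * #|cut B|%:R)) * expR (b * energy z)
     * \sum_u expR (b * energy u).
Proof.
move=> b0; set k : R := #|cut B|%:R.
apply: (@le_trans _ _ (\sum_(u : {ffun V -> bool} | u v == s)
  expR (b * (3 * k)) * expR (b * energy z) * expR (b * inner B u))).
  apply: ler_sum => u _; rewrite -!expRD -!mulrDr ler_expR.
  apply: ler_wpM2l => //; rewrite !(energyE B).
  have := inner_merge B u z.
  have := norm_cross_le B (merge B u z); have := norm_cross_le B (merge B z u).
  have := norm_cross_le B z; rewrite !ler_norml -/k.
  by move=> /andP[? ?] /andP[? ?] /andP[? ?] ?; lra.
rewrite -mulr_sumr sum_inner_spin mulrCA !mulrA.
apply: ler_wpM2l; last exact: sum_inner_le.
by rewrite !mulr_ge0 ?expR_ge0 ?invr_ge0.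
Qed.

End Cut.

(** * The square grid and its row-by-row sweep *)

Section Grid.
Variable n : nat.
Implicit Types (v w : site n) (x y z u : config n).

(** The possible edges of the grid: [inl (j, (a, b))] joins [(a, j)] to [(b, j)]
    and [inr (i, (a, b))] joins [(i, a)] to [(i, b)]; only those with
    [b = a + 1] are kept. *)
Notation edge := (('I_n * ('I_n * 'I_n)) + ('I_n * ('I_n * 'I_n)))%type.

Definition grid_edge (e : edge) : bool :=
  match e with
  | inl (_, p) => p.2 == p.1.+1 :> nat
  | inr (_, p) => p.2 == p.1.+1 :> nat
  end.
Definition grid_src (e : edge) : site n :=
  match e with inl (j, p) => (p.1, j) | inr (i, p) => (i, p.1) end.
Definition grid_tgt (e : edge) : site n :=
  match e with inl (j, p) => (p.2, j) | inr (i, p) => (i, p.2) end.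

Lemma interactionE (R : realType) x :
  interaction R x = energy R grid_edge grid_src grid_tgt x.
Proof.
rewrite /energy big_sumType /= /interaction; congr (_ + _);
  rewrite (pair_big_dep xpredT
    (fun _ (p : 'I_n * 'I_n) => p.2 == p.1.+1 :> nat)) /=;
  by apply: eq_big => [] [].
Qed.

(** The rank of a site in the lexicographic order, starting from [0]. *)
Definition rank v : nat := (v.1 * n + v.2)%N.

(** The first [k] sites in that order. *)
Definition before (k : nat) : {set site n} := [set w | (rank w < k)%N].

Lemma rank_inj : injective rank.
Proof.
move=> [i j] [i' j'] /=; rewrite /rank /= => E.
have jn := ltn_ord j; have jn' := ltn_ord j'.
have Ei : i = i'.
  apply/val_inj; have := congr1 (divn^~ n) E.
  by rewrite /= !divnMDl ?(leq_ltn_trans (leq0n j) jn) // !divn_small ?addn0.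
by subst i'; congr (_, _); apply/val_inj; exact: addnI E.
Qed.

Lemma rank_lt v : (rank v < n ^ 2)%N.
Proof.
case: v => i j; rewrite /rank /=; have := ltn_ord i; have := ltn_ord j; nia.
Qed.

(** A sum over the steps of the sweep is a sum over the sites. *)
Lemma big_rank (V : nmodType) (F : nat -> V) :
  \sum_(k < n ^ 2) F k = \sum_v F (rank v).
Proof.
have bij : bijective (fun v => Ordinal (rank_lt v)).
  apply: inj_card_bij; first by move=> v w /(congr1 val) /rank_inj.
  by rewrite card_ord card_prod card_ord expnS expn1.
by rewrite (reindex _ (onW_bij _ bij)).
Qed.

Lemma beforeS v : before (rank v).+1 = v |: before (rank v).
Proof.
by apply/setP => w; rewrite !inE ltnS leq_eqVlt (inj_eq rank_inj).
Qed.

Lemma before0 : before 0 = set0.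
Proof. by apply/setP => w; rewrite !inE. Qed.

Lemma beforeT : before (n ^ 2) = setT.
Proof. by apply/setP => w; rewrite !inE rank_lt. Qed.

(** Of the edges in direction [i], one at most per value of [j] leaves an
    initial segment, and of those in direction [j] only the edge that starts
    at the last site of the segment can. *)
Lemma card_cut_before k :
  (#|cut grid_edge grid_src grid_tgt (before k)| <= n + 1)%N.
Proof.
pose h (e : edge) : option 'I_n := if e is inl (j, _) then Some j else None.
have h_inj : {in cut grid_edge grid_src grid_tgt (before k) &, injective h}.
  move=> [[j [a b]]|[j [a b]]] [[j' [a' b']]|[j' [a' b']]] //=;
    rewrite !inE /rank /=.
  - move=> /andP[/eqP Eb H] /andP[/eqP Eb' H'] [Ej]; subst j'.
    have Ea : a = a'.
      apply/val_inj; move: H H'; rewrite Eb Eb' /=.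
      by case: ltnP; case: ltnP => //; case: ltnP; case: ltnP => //; nia.
    by subst a'; congr (inl (_, (_, _))); apply/val_inj; rewrite /= Eb Eb'.
  - move=> /andP[/eqP Eb H] /andP[/eqP Eb' H'] _.
    have E : rank (j, a) = rank (j', a').
      by move: H H'; rewrite /rank /= Eb Eb'; lia.
    move/rank_inj: E => [Ej Ea]; subst j' a'.
    by congr (inr (_, (_, _))); apply/val_inj; rewrite /= Eb Eb'.
have := max_card [set h e | e in cut grid_edge grid_src grid_tgt (before k)].
by rewrite card_in_imset // card_option card_ord addn1.
Qed.

End Grid.

(** * The Ising measure and the generator of the Gibbs sampler *)

Section Gibbs.
Variables (R : realType) (n : nat) (T : R).
Implicit Types (v w : site n) (x y z u : config n) (f : config n -> R).

Local Notation pi := (@ising R n T).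

Lemma weight_gt0 x : 0 < weight T x.
Proof. exact: expR_gt0. Qed.

Lemma partition_fun_gt0 : 0 < partition_fun n T.
Proof.
rewrite /partition_fun (bigD1 [ffun=> true]) //=.
by rewrite ltr_pwDl ?weight_gt0 // sumr_ge0 // => x _; rewrite ltW ?weight_gt0.
Qed.

Lemma ising_gt0 x : 0 < pi x.
Proof. by rewrite mulr_gt0 ?invr_gt0 ?partition_fun_gt0 ?weight_gt0. Qed.

Lemma sum_ising : \sum_x pi x = 1.
Proof. by rewrite -mulr_sumr mulVf // gt_eqF ?partition_fun_gt0. Qed.

Lemma setspinN x v : setspin x v (~~ x v) = flip [set v] x.
Proof.
apply/ffunP => w; rewrite !ffunE inE.
by case: eqP => [->|]; rewrite ?addbT ?addbF.
Qed.

Lemma setspin_id x v : setspin x v (x v) = x.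
Proof. by apply/ffunP => w; rewrite !ffunE; case: eqP => [->|]. Qed.

Lemma flip_site x v : flip [set v] x v = ~~ x v.
Proof. by rewrite !ffunE set11 addbT. Qed.

Lemma flip_site_neq x v w : w != v -> flip [set v] x w = x w.
Proof. by move=> /negbTE wv; rewrite !ffunE inE wv addbF. Qed.

Lemma cond_isingN v x :
  cond_ising T v (~~ x v) x
  = pi (flip [set v] x) / (pi x + pi (flip [set v] x)).
Proof. by rewrite /cond_ising negbK setspin_id setspinN [pi x + _]addrC. Qed.

(** The rate of the equilibrium flow between [x] and [x] reversed at [v],
    without the factor [n ^ -2] for the choice of [v]. *)
Definition flow v x : R := pi x * cond_ising T v (~~ x v) x.

Lemma flow_flip v x : flow v (flip [set v] x) = flow v x.
Proof.
rewrite /flow !cond_isingN flipK [pi (flip _ _) + _]addrC.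
exact: mulrCA.
Qed.

Lemma dist_flip v x : dist x (flip [set v] x) = 1%N.
Proof.
rewrite /dist -(cards1 v); apply: eq_card => w; rewrite !inE.
case: (eqVneq w v) => [->|wv]; rewrite ?flip_site ?flip_site_neq ?eqxx //.
by case: (x v).
Qed.

Lemma gibbs_offdiag x y : x != y ->
  gibbs T x y
  = \sum_v (y == flip [set v] x)%:R * ((n%:R ^+ 2)^-1 * cond_ising T v (~~ x v) x).
Proof.
move=> xy; rewrite /gibbs (negbTE xy); case: eqP => [d1|d1].
  have /cards1P[v Ev] : #|[set v | x v != y v]| == 1%N by apply/eqP.
  have yE : y = flip [set v] x.
    apply/ffunP => w; move/setP/(_ w): Ev; rewrite !inE !ffunE inE.
    by case: (x w) (y w) (w == v) => [] [] [].
  have neq w : (x w != y w) = (w == v) by move/setP/(_ w): Ev; rewrite !inE.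
  case: pickP => [w|/(_ v)]; last by rewrite neq eqxx.
  rewrite neq => /eqP->; subst y.
  rewrite (bigD1 v) //= eqxx mul1r big1 ?addr0 ?flip_site //.
  move=> w' w'v; case: eqP => [E|]; rewrite ?mul0r //.
  by have := neq w'; rewrite E flip_site (negbTE w'v); case: (x w').
rewrite big1 // => v _; case: eqP => [E|]; rewrite ?mul0r //.
by case: d1; rewrite E dist_flip.
Qed.

Lemma gibbs_apply f x :
  \sum_y gibbs T x y * f y
  = f x - (n%:R ^+ 2)^-1
      * \sum_v cond_ising T v (~~ x v) x * (f x - f (flip [set v] x)).
Proof.
rewrite (bigD1 x) //= {1}/gibbs eqxx.
have -> : \sum_(y | y != x) gibbs T x y * f y
    = (n%:R ^+ 2)^-1 * \sum_v cond_ising T v (~~ x v) x * f (flip [set v] x).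
  under eq_bigr => y yx do rewrite gibbs_offdiag 1?eq_sym // mulr_suml.
  rewrite exchange_big mulr_sumr; apply: eq_bigr => v _ /=.
  rewrite (bigD1 (flip [set v] x)) /=; last first.
    by apply/eqP => /ffunP/(_ v); rewrite flip_site; case: (x v).
  rewrite eqxx mul1r big1 ?addr0; first exact/esym/mulrA.
  by move=> y /andP[_ /negbTE->]; rewrite !mul0r.
under [in RHS]eq_bigr do rewrite mulrBr.
by rewrite sumrB -mulr_suml; ring.
Qed.

(** The Dirichlet form of the Gibbs sampler. *)
Lemma dirichlet_gibbs f :
  \sum_x pi x * f x * (f x - \sum_y gibbs T x y * f y)
  = (2 * n%:R ^+ 2)^-1
    * \sum_v \sum_x flow v x * (f (flip [set v] x) - f x) ^+ 2.
Proof.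
have -> : \sum_x pi x * f x * (f x - \sum_y gibbs T x y * f y)
   = (n%:R ^+ 2)^-1 * \sum_v \sum_x flow v x * (f x * (f x - f (flip [set v] x))).
  rewrite exchange_big mulr_sumr; apply: eq_bigr => x _.
  rewrite gibbs_apply opprB addrC subrK mulrCA mulr_sumr; congr (_ * _).
  by apply: eq_bigr => v _; rewrite /flow; ring.
rewrite (invfM 2) [2^-1 * _]mulrC -[RHS]mulrA; congr (_ * _); rewrite mulr_sumr.
apply: eq_bigr => v _.
set S := \sum_x _.
have E : S = \sum_x flow v x
    * (f (flip [set v] x) * (f (flip [set v] x) - f x)).
  rewrite /S (reindex_inj (flip_inj (B := [set v]))) /=.
  by apply: eq_bigr => x _; rewrite flow_flip flipK.
have -> : S = 2^-1 * (S + S) by field.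
by rewrite {1}/S E -big_split /=; congr (_ * _); apply: eq_bigr => x _; ring.
Qed.

Lemma sum_ising_gibbs f :
  \sum_x pi x * (\sum_y gibbs T x y * f y) = \sum_x pi x * f x.
Proof.
under eq_bigr do rewrite gibbs_apply mulrBr mulrCA mulr_sumr.
rewrite sumrB -mulr_sumr exchange_big /= [X in _ * X]big1 ?mulr0 ?subr0 // => v _.
set S := \sum_x _.
suff : S = - S by move=> ?; apply/eqP; rewrite -[S == 0](mulrn_eq0 S 2) mulr2n; lra.
rewrite -sumrN /S (reindex_inj (flip_inj (B := [set v]))) /=.
apply: eq_bigr => x _; have := flow_flip v x; rewrite flipK /flow => E.
by rewrite -!mulrN opprB (mulrA (pi _)) E; exact/esym/mulrA.
Qed.

End Gibbs.

(** * The Poincare inequality *)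

Lemma sqr_sum_le (R : realDomainType) (I : finType) (a : I -> R) :
  (\sum_i a i) ^+ 2 <= #|I|%:R * \sum_i a i ^+ 2.
Proof.
have : 0 <= \sum_i \sum_j (a i - a j) ^+ 2.
  by rewrite !sumr_ge0 // => i _; rewrite sumr_ge0 // => j _; exact: sqr_ge0.
have -> : \sum_i \sum_j (a i - a j) ^+ 2
    = 2 * (#|I|%:R * \sum_i a i ^+ 2) - 2 * (\sum_i a i) ^+ 2.
  transitivity (\sum_i (#|I|%:R * a i ^+ 2 + \sum_j a j ^+ 2
                        - 2 * (a i * \sum_j a j))).
    apply: eq_bigr => i _.
    transitivity (\sum_j (a i ^+ 2 + a j ^+ 2 - 2 * (a i * a j))).
      by apply: eq_bigr => j _; ring.
    by rewrite sumrB big_split /= sumr_const -[_ *+ #|_|]mulr_natl -!mulr_sumr.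
  rewrite sumrB big_split /= sumr_const -[_ *+ #|_|]mulr_natl -!mulr_sumr.
  by rewrite -mulr_suml; ring.
lra.
Qed.

Lemma sum_sqr_diff (R : comNzRingType) (S : finType) (p f : S -> R) :
  \sum_x p x = 1 -> \sum_x p x * f x = 0 ->
  \sum_x \sum_y p x * p y * (f y - f x) ^+ 2 = 2 * \sum_x p x * f x ^+ 2.
Proof.
move=> p1 f0.
transitivity (\sum_x (p x * \sum_y p y * f y ^+ 2 + p x * f x ^+ 2)).
  apply: eq_bigr => x _.
  transitivity (\sum_y (p x * (p y * f y ^+ 2) + p x * f x ^+ 2 * p y
                        - 2 * p x * f x * (p y * f y))).
    by apply: eq_bigr => y _; ring.
  by rewrite sumrB big_split /= -!mulr_sumr f0 p1 mulr0 subr0 mulr1.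
by rewrite big_split /= -mulr_suml p1; ring.
Qed.

Section Poincare.
Variables (R : realType) (n : nat) (T : R).
Hypothesis T0 : 0 < T.
Implicit Types (v w : site n) (x y z u : config n) (f : config n -> R).

Local Notation pi := (@ising R n T).

Let M : R := expR (T^-1 * (3 * (n%:R + 1))).

Lemma sum_ising_merge_le k z v s :
  \sum_(u : config n | u v == s)
    pi (merge (before n k) u z) * pi (merge (before n k) z u)
  <= 2^-1 * M * pi z.
Proof.
have b0 : 0 <= T^-1 by rewrite invr_ge0 ltW.
have Z0 := partition_fun_gt0 n T.
have Zi0 : 0 <= (partition_fun n T)^-1 by rewrite invr_ge0 ltW.
have := @sum_merge_le R _ _ (@grid_edge n) (@grid_src n) (@grid_tgt n)
  T^-1 (before n k) z v s b0.
have eW x : expR (T^-1 * energy R (@grid_edge n) (@grid_src n) (@grid_tgt n) x)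
    = weight T x by rewrite /weight interactionE.
under eq_bigr do rewrite !eW.
rewrite eW (eq_bigr _ (fun x _ => eW x)) -/(partition_fun n T) => H.
have -> : \sum_(u : config n | u v == s)
    pi (merge (before n k) u z) * pi (merge (before n k) z u)
  = (partition_fun n T)^-1 ^+ 2 * \sum_(u : config n | u v == s)
    weight T (merge (before n k) u z) * weight T (merge (before n k) z u).
  by rewrite mulr_sumr; apply: eq_bigr => u _; rewrite /ising; ring.
apply: (le_trans (ler_wpM2l _ H)); first exact: sqr_ge0.
set c := #|_|%:R.
have -> : (partition_fun n T)^-1 ^+ 2 * (2^-1 * expR (T^-1 * (3 * c)) * weight T z
    * partition_fun n T) = 2^-1 * expR (T^-1 * (3 * c)) * pi z.
  by rewrite /ising; field; rewrite gt_eqF.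
rewrite ler_pM2r ?ising_gt0 // ler_pM2l ?invr_gt0 // ler_expR.
apply: ler_wpM2l => //; apply: ler_wpM2l => //.
by rewrite /c natr1 -addn1 ler_nat card_cut_before.
Qed.

(** The total mass of the pairs of configurations whose path crosses the edge
    from [z] to [z] reversed at [v]. *)
Definition load v z : R :=
  \sum_(u : config n | u v == ~~ z v)
    pi (merge (before n (rank v)) u z) * pi (merge (before n (rank v)) z u).

(** The same load, indexed by the configurations complementary to the far end
    of the edge rather than to the near end. *)
Lemma load_flip v z :
  load v z =
  \sum_(u : config n | u v == z v)
    pi (merge (before n (rank v).+1) u (flip [set v] z))
    * pi (merge (before n (rank v).+1) (flip [set v] z) u).
Proof.
rewrite /load (reindex_inj (flip_inj (B := [set v]))) /=.
apply: eq_big => u; first by rewrite flip_site; case: (u v) (z v) => [] [].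
rewrite flip_site => /eqP/negb_inj uv; rewrite beforeS.
have vB : v \notin before n (rank v) by rewrite inE ltnn.
congr (pi _ * pi _); apply/ffunP => w; rewrite !ffunE !inE.
  by case: (eqVneq w v) => [->|wv] /=; rewrite ?ltnn ?addbF ?uv.
by case: (eqVneq w v) => [->|wv] /=; rewrite ?ltnn ?addbF ?uv.
Qed.

Lemma load_le_flow v z : load v z <= M * flow T v z.
Proof.
have H1 : load v z <= 2^-1 * M * pi z by exact: sum_ising_merge_le.
have H2 : load v z <= 2^-1 * M * pi (flip [set v] z).
  by rewrite load_flip; exact: sum_ising_merge_le.
rewrite /flow cond_isingN.
have p0 := ising_gt0 T z; have q0 := ising_gt0 T (flip [set v] z).
move: p0 q0 H1 H2; set p := pi z; set q := pi _; move=> p0 q0 H1 H2.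
rewrite (mulrA p) (mulrA M) ler_pdivlMr ?addr_gt0 // mulrDr.
have := ler_wpM2r (ltW q0) H1; have := ler_wpM2r (ltW p0) H2.
lra.
Qed.

(** The path from [x] to [y] replaces the spins of [x] by those of [y] one
    site at a time, in lexicographic order. *)
Lemma path_sqr_le f x y :
  (f y - f x) ^+ 2
  <= n%:R ^+ 2 * \sum_(v : site n) (f (merge (before n (rank v).+1) y x)
                         - f (merge (before n (rank v)) y x)) ^+ 2.
Proof.
pose g k := f (merge (before n k) y x).
have <- : \sum_(k < n ^ 2) (g k.+1 - g k) = f y - f x.
  rewrite -(big_mkord xpredT (fun k => g k.+1 - g k)) telescope_sumr // /g.
  rewrite before0 beforeT.
  by congr (f _ - f _); apply/ffunP => v; rewrite !ffunE inE.
apply: (le_trans (sqr_sum_le _)); rewrite card_ord natrX.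
by rewrite -(@big_rank n _ (fun k => (g k.+1 - g k) ^+ 2)).
Qed.

Lemma merge_step v x y :
  merge (before n (rank v).+1) y x
  = setspin (merge (before n (rank v)) y x) v (y v).
Proof.
rewrite beforeS; apply/ffunP => w; rewrite !ffunE !inE.
by case: (eqVneq w v) => [->|].
Qed.

(** Exchanging the two configurations on the initial segment turns the sum
    over the pairs [(x, y)] into the sum over the pairs [(z, u)], where [z] is
    the point reached by the path from [x] to [y]. *)
Lemma sum_path_step f v :
  \sum_x \sum_y pi x * pi y * (f (merge (before n (rank v).+1) y x)
                               - f (merge (before n (rank v)) y x)) ^+ 2
  = \sum_z load v z * (f (flip [set v] z) - f z) ^+ 2.
Proof.
set B := before n (rank v).
have vB : v \in B = false by rewrite inE ltnn.
rewrite pair_big /=.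
pose h (p : config n * config n) := (merge B p.2 p.1, merge B p.1 p.2).
have hK : involutive h by move=> [x y]; rewrite /h /= !merge_merge.
rewrite (reindex_inj (inv_inj hK)) /=.
rewrite -(pair_big xpredT xpredT (fun z u => pi (merge B u z) * pi (merge B z u)
  * (f (merge (before n (rank v).+1) (merge B z u) (merge B u z))
     - f (merge B (merge B z u) (merge B u z))) ^+ 2)) /=.
apply: eq_bigr => z _.
rewrite /load mulr_suml [RHS]big_mkcond /=; apply: eq_bigr => u _.
rewrite merge_step -/B merge_merge !ffunE vB.
case: eqP => [->|uv]; first by rewrite setspinN.
have -> : u v = z v by case: (u v) (z v) uv => [] [].
by rewrite setspin_id subrr expr0n mulr0.
Qed.

Lemma poincare f : (0 < n)%N -> \sum_x pi x * f x = 0 ->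
  \sum_x pi x * f x ^+ 2
  <= n%:R ^+ 4 * M
     * \sum_x pi x * f x * (f x - \sum_y gibbs T x y * f y).
Proof.
move=> n0 f0.
have varE := sum_sqr_diff (sum_ising n T) f0.
rewrite dirichlet_gibbs.
rewrite -(ler_pM2l (_ : 0 < 2)) // -varE.
apply: (@le_trans _ _ (n%:R ^+ 2 * \sum_v \sum_z load v z
                         * (f (flip [set v] z) - f z) ^+ 2)).
  rewrite -(eq_bigr _ (fun v _ => sum_path_step f v)).
  rewrite [in leRHS]exchange_big mulr_sumr; apply: ler_sum => x _ /=.
  rewrite [in leRHS]exchange_big mulr_sumr; apply: ler_sum => y _ /=.
  have pxy : 0 <= pi x * pi y by rewrite mulr_ge0 // ltW ?ising_gt0.
  apply: (le_trans (ler_wpM2l pxy (path_sqr_le f x y))).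
  by rewrite mulrCA mulr_sumr.
have nN0 : (n%:R : R) != 0 by rewrite pnatr_eq0 -lt0n.
set D := \sum_v \sum_x flow T v x * _.
have -> : 2 * (n%:R ^+ 4 * M * ((2 * n%:R ^+ 2)^-1 * D)) = n%:R ^+ 2 * (M * D).
  by field.
rewrite ler_wpM2l ?sqr_ge0 // /D mulr_sumr; apply: ler_sum => v _.
rewrite mulr_sumr; apply: ler_sum => z _.
by rewrite mulrA ler_wpM2r ?sqr_ge0 // load_le_flow.
Qed.

End Poincare.

(** * The bound on the second eigenvalue *)

Lemma char_poly_tr (R : comNzRingType) (m : nat) (A : 'M[R]_m) :
  char_poly A^T = char_poly A.
Proof.
by rewrite /char_poly -det_tr /char_poly_mx linearB /= tr_scalar_mx map_trmx trmxK.
Qed.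

Lemma root_char_poly_col (F : fieldType) (m : nat) (A : 'M[F]_m) (b : F) :
  root (char_poly A) b -> exists2 w : 'cV[F]_m, A *m w = b *: w & w != 0.
Proof.
rewrite -char_poly_tr -eigenvalue_root_char => /eigenvalueP[w Aw w0].
exists w^T; first by rewrite -[A]trmxK -trmx_mul Aw linearZ.
by apply: contraNneq w0 => /(congr1 trmx); rewrite trmxK trmx0 => ->.
Qed.

Lemma sum_enum_val (V : nmodType) (S : finType) (F : S -> V) :
  \sum_(i < #|S|) F (enum_val i) = \sum_x F x.
Proof. by rewrite -(big_enum_val F). Qed.

Section Spectrum.
Variables (R : realType) (n : nat) (T : R).
Hypotheses (n0 : (0 < n)%N) (T0 : 0 < T).

Local Notation pi := (@ising R n T).
Let A := kernel_mx (@gibbs R n T).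
Let u : 'cV[R]_#|{: config n}| := const_mx 1.
Let v : 'rV[R]_#|{: config n}| := \row_j pi (enum_val j).
Let gap : R := (n%:R ^+ 4)^-1 * expR (- (T^-1 * (3 * (n%:R + 1)))).

Lemma gibbs_const : A *m u = u.
Proof.
apply/matrixP => i j; rewrite !mxE.
under eq_bigr do rewrite !mxE.
rewrite (sum_enum_val (fun y => gibbs T (enum_val i) y * 1)).
rewrite (gibbs_apply T (fun=> 1)) big1 ?mulr0 ?subr0 // => w _.
by rewrite subrr mulr0.
Qed.

Lemma ising_mass : v *m u = 1%:M.
Proof.
apply/matrixP => i j; rewrite !mxE !ord1 eqxx.
under eq_bigr do rewrite !mxE mulr1.
by rewrite (sum_enum_val pi) sum_ising.
Qed.

Lemma gap_le1 : gap <= 1.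
Proof.
rewrite /gap mulr_ile1 ?expR_ge0 ?invr_ge0 ?exprn_ge0 ?ler0n //.
  by rewrite invf_le1 ?exprn_gt0 ?ltr0n // exprn_ege1 // ler1n.
rewrite -[leRHS]expR0 ler_expR oppr_le0 mulr_ge0 ?invr_ge0 ?(ltW T0) //.
by rewrite mulr_ge0 ?addr_ge0 ?ler0n.
Qed.

(** A right eigenvector of the deflated kernel for an eigenvalue other than
    [0] is centered, hence an eigenvector of the kernel to which the Poincare
    inequality applies. *)
Lemma deflated_root_le b : root (char_poly (A - u *m v)) b -> b <= 1 - gap.
Proof.
have [->|b0] := eqVneq b 0; first by rewrite subr_ge0 gap_le1.
case/root_char_poly_col => w Bw w0.
pose f x := w (enum_rank x) ord0.
have fE i : w i ord0 = f (enum_val i) by rewrite /f enum_valK.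
have Bf x : \sum_y gibbs T x y * f y - \sum_y pi y * f y = b * f x.
  have /matrixP/(_ (enum_rank x) ord0) := Bw.
  rewrite mulmxBl -mulmxA !mxE => E; rewrite /f -E; congr (_ - _).
    rewrite -(sum_enum_val (fun y => gibbs T x y * f y)).
    by apply: eq_bigr => i _; rewrite !mxE enum_rankK fE.
  rewrite big_ord1 !mxE mul1r -(sum_enum_val (fun y => pi y * f y)).
  by apply: eq_bigr => i _; rewrite !mxE fE.
have f_mean : \sum_y pi y * f y = 0.
  have : b * (\sum_y pi y * f y) = 0.
    rewrite mulr_sumr; under eq_bigr do rewrite mulrCA -Bf mulrBr.
    by rewrite sumrB sum_ising_gibbs -mulr_suml sum_ising mul1r subrr.
  by move/eqP; rewrite mulf_eq0 (negbTE b0) => /eqP.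
have Pf x : \sum_y gibbs T x y * f y = b * f x.
  by rewrite -Bf f_mean subr0.
have [x0 fx0] : exists x, f x != 0.
  apply/existsP; apply: contraNT w0 => /existsPn H; apply/eqP/matrixP => i j.
  by rewrite !mxE ord1 fE; apply/eqP; rewrite -[_ == _]negbK H.
have pos : 0 < \sum_x pi x * f x ^+ 2.
  rewrite (bigD1 x0) //= ltr_pwDl //.
    by apply: mulr_gt0; [exact: ising_gt0 | rewrite exprn_even_gt0].
  by rewrite sumr_ge0 // => x _; rewrite mulr_ge0 ?sqr_ge0 // ltW // ising_gt0.
have dirE : \sum_x pi x * f x * (f x - \sum_y gibbs T x y * f y)
    = (1 - b) * \sum_x pi x * f x ^+ 2.
  by rewrite mulr_sumr; apply: eq_bigr => x _; rewrite Pf; ring.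
have := poincare T0 n0 f_mean; rewrite dirE (mulrA _ (1 - b)) ler_pMl // => H.
rewrite lerBrDl -lerBrDr /gap expRN -invfM.
have K0 : 0 < n%:R ^+ 4 * expR (T^-1 * (3 * (n%:R + 1))).
  by rewrite mulr_gt0 ?expR_gt0 // exprn_gt0 // ltr0n.
by rewrite -(ler_pM2l K0) mulfV ?gt_eqF.
Qed.

Lemma gibbs_beta1_le : beta A 1 <= 1 - gap.
Proof.
apply: (beta1_le gibbs_const ising_mass); last exact: deflated_root_le.
by rewrite subr_ge0 gap_le1.
Qed.

End Spectrum.

Theorem theorem2 (R : realType) (n : nat) (T : R) (hn : (1 <= n)%N) (hT : 0 < T) :
  beta (kernel_mx (@gibbs R n T)) 1
  <= 1 - (n%:R ^+ 4)^-1 * expR (- (2 / T * (2 * n%:R + 1))).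
Proof.
apply: (le_trans (gibbs_beta1_le hn hT)).
rewrite lerD2l lerN2 ler_wpM2l ?invr_ge0 ?exprn_ge0 // ler_expR lerN2.
(* 3 (n + 1) <= 2 (2 n + 1) as soon as n >= 1 *)
rewrite [2 / T]mulrC -mulrA ler_pM2l ?invr_gt0 //.
have : 1 <= n%:R :> R by rewrite ler1n.
lra.
Qed.
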